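(* Assume the generic conditions. The kernels $K^{\mu,\nu}_n(x,y)$, $\mu,\nu=0,1,2$, have the bilinear forms $$\pi_{n}\eta_{n}(x+y) K^{\mu,\nu}_{n}(x,y) = \mathbf{P}_{n}^{(\mu)}(x)^{T} G_{n}(x,y) \mathbf{Q}_{n}^{(\nu)}(y),$$ where $G_n(x,y)$ is the $3\times3$ matrix $$G_{n}(x,y) = \begin{pmatrix} \frac{S_{n}^2}{S_{n+1}^2} & \frac{S_{n}}{S_{n+1}}(Y_{n,n}-y) & -\frac{S_{n-1}}{S_{n+1}} \\ \frac{S_{n}}{S_{n+1}}(X_{n,n}-x) & (X_{n,n}+y)(Y_{n,n}+x) & \frac{S_{n-1}}{S_{n}}(Y_{n,n}+x) \\ -\frac{S_{n-1}}{S_{n+1}} & \frac{S_{n-1}}{S_{n}}(X_{n,n}+y) & \frac{S_{n-1}^2}{S_{n}^2} \end{pmatrix}.$$ The last column of $G_n$ is proportional to the components of $\hat P_n(x)$, and the last row is proportional to the components of $\check Q_n(y)$ (components meaning the coefficients in $\pi_n\hat P_n=\frac{S_n}{S_{n+1}}P_{n+1}-(Y_{n,n}+x)P_n-\frac{S_{n-1}}{S_n}P_{n-1}$ and $\eta_n\check Q_n=\frac{S_n}{S_{n+1}}Q_{n+1}-(X_{n,n}+y)Q_n-\frac{S_{n-1}}{S_n}Q_{n-1}$). The characteristic polynomial of $G_n$ gives the cubic spectral curve $$\det(G_{n}(x,y) - \lambda I_3) = -\lambda^3 + \Big( \tfrac{S_{n}^2}{S_{n+1}^2}+\tfrac{S_{n-1}^2}{S_{n}^2}+(Y_{n,n}+x)(X_{n,n}+y)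 \Big)\lambda^2 - \pi_{n}\eta_{n} \tfrac{S_{n}^2}{S_{n+1}^2}(x+y)\lambda - \pi_{n}^2\eta_{n}^2\tfrac{S_{n-1}^2}{S_{n+1}^2}.$$ The anti-incidence formulae (the case $y=-x$ of the kernel evaluations) are then expressions of orthogonality, with respect to the bilinear form given by $G_n(x,-x)$, between $\mathbf P_n^{(0)}(x),\mathbf P_n^{(1)}(x)$ on the one hand and $\mathbf Q_n^{(0)}(-x),\mathbf Q_n^{(1)}(-x)$ on the other, i.e. $\mathbf P_n^{(\mu)}(x)^TG_n(x,-x)\mathbf Q_n^{(\nu)}(-x)=0$ for $\mu,\nu\in\{0,1\}$. Furthermore $G_n$ is invertible if $n\ge1$, and $$\pi_{n}\eta_{n}G_{n}(x,y)^{-1} = \begin{pmatrix} 0 & \frac{S_{n+1}}{S_{n}} & -\frac{S_{n+1}}{S_{n-1}}(Y_{n,n}+x) \\ \frac{S_{n+1}}{S_{n}} & 0 & \frac{S_{n}}{S_{n-1}} \\ -\frac{S_{n+1}}{S_{n-1}}(X_{n,n}+y) & \frac{S_{n}}{S_{n-1}} & -\frac{S_{n}^2}{S_{n-1}^2}(x+y) \end{pmatrix}.$$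
   Context: Let $w_1,w_2$ be densities supported on $S_1,S_2\subset\mathbb R_+$, and $\langle f,g\rangle=\int_{S_1\times S_2}\frac{w_1(x)w_2(y)}{x+y}f(x)g(y)\,dx\,dy$. Put $M_{j,k}=\langle x^j,y^k\rangle$, $Z_0=1$, $Z_n=\det(M_{j,k})_{0\le j,k\le n-1}$. $P_n,Q_n$ are polynomials of degree $n$ with the same leading coefficient $S_n$ ($S_n^2=Z_n/Z_{n+1}$) and $\langle P_m,Q_n\rangle=\delta_{m,n}$; objects with index $-1$ are $0$. $\pi_n=\int_{S_1}w_1P_n\,dx$, $\eta_n=\int_{S_2}w_2Q_n\,dy$; $X_{n,n}=\langle xP_n,Q_n\rangle$, $Y_{n,n}=\langle P_n,yQ_n\rangle$ (so $X_{n,n}+Y_{n,n}=\pi_n\eta_n$); $\hat P_n=-\sum_{k=0}^n\eta_kP_k$, $\check Q_n=-\sum_{j=0}^n\pi_jQ_j$. Generic conditions: all moments $M_{j,k}$ finite, $Z_n\ne0$, and $\pi_n,\eta_n\ne0$ for all $n\ge0$. $P_n^{(0)}=P_n$, $P^{(1)}_n(z)=\int_{S_1}\frac{w_1(x)}{z-x}P_n(x)\,dx$, $P^{(2)}_n(z)=\int_{S_1\times S_2}\frac{w_1(x)w_2(y)}{x+y}\frac{P_n(x)}{z-x}\,dx\,dy$; $Q_n^{(0)}=Q_n$, $Q^{(1)}_n(z)=\int_{S_2}\frac{w_2(y)}{z-y}Q_n(y)\,dy$, $Q^{(2)}_n(z)=\int_{S_1\times S_2}\frac{w_1(x)w_2(y)}{x+y}\frac{Q_n(y)}{z-y}\,dx\,dy$.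 Column vectors: $\mathbf P_n^{(\mu)}=(P^{(\mu)}_{n+1},P^{(\mu)}_n,P^{(\mu)}_{n-1})^T$, $\mathbf Q_n^{(\nu)}=(Q^{(\nu)}_{n+1},Q^{(\nu)}_n,Q^{(\nu)}_{n-1})^T$. $f_1(z)=\int_{S_1}\frac{w_1(x)}{z-x}dx$, $f_2(z)=\int_{S_2}\frac{w_2(y)}{z-y}dy$, $g_1(z)=\int_{S_1\times S_2}\frac{w_1(x)w_2(y)}{(x+y)(z-x)}dxdy$, $g_2(z)=\int_{S_1\times S_2}\frac{w_1(x)w_2(y)}{(x+y)(z-y)}dxdy$. Kernels: $K^{\mu,\nu}_n(x,y)=\sum_{l=0}^nP^{(\mu)}_l(x)Q^{(\nu)}_l(y)+c^{\mu,\nu}(x,y)$ with $c^{0,0}=c^{0,1}=c^{1,0}=0$, $c^{1,1}=\frac1{x+y}$, $c^{0,2}=c^{2,0}=-\frac1{x+y}$, $c^{1,2}=-\frac{f_1(x)}{x+y}$, $c^{2,1}=-\frac{f_2(y)}{x+y}$, $c^{2,2}=-\frac{g_1(x)+g_2(y)}{x+y}$.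
   Formalization: The kernel identity is stated for n≥1 (all μ,ν) and for n=0 only with μ,ν≤1, as it fails at n=0 when μ or ν is 2; the anti-incidence value for μ=ν=1 is π_nη_n instead of 0, as (x+y)K^{1,1} equals 1 at y=−x. *)

(* Defs.v *)
From HB Require Import structures.
From mathcomp Require Import all_boot all_order all_algebra.
From mathcomp Require Import all_classical all_reals all_analysis.
From mathcomp Require Export complex.

Set Implicit Arguments.
Unset Strict Implicit.
Unset Printing Implicit Defensive.

Import Order.TTheory GRing.Theory Num.Theory.
Import numFieldNormedType.Exports.
Local Open Scope classical_set_scope.
Local Open Scope ring_scope.
Local Open Scope complex_scope.

Definition leb {R : realType} : {measure set (measurableTypeR R) -> \bar R} :=
  @lebesgue_measure R.

Definition leb2 {R : realType} :
    {measure set (measurableTypeR R * measurableTypeR R) -> \bar R} :=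
  (@leb R \x @leb R)%E.

(* Lebesgue integral of a complex-valued function, componentwise. *)
Definition cintegral {d : measure_display} {T : measurableType d} {R : realType}
    (mu : {measure set T -> \bar R}) (D : set T) (f : T -> R[i]) : R[i] :=
  (\int[mu]_(t in D) complex.Re (f t)) +i* (\int[mu]_(t in D) complex.Im (f t)).

(* Two real densities on subsets of [0, +oo[.  They are not assumed to be
   nonnegative: the nonvanishing of Z_n, pi_n and eta_n is assumed separately
   in [generic]. *)
Record weights (R : realType) := Weights {
  S1 : set R; S2 : set R; w1 : R -> R; w2 : R -> R }.

Definition is_density {R : realType} (D : set R) (w : R -> R) : Prop :=
  [/\ measurable (D : set (measurableTypeR R)),
      (forall t, D t -> 0 <= t),
      measurable_fun [set: measurableTypeR R] (w : measurableTypeR R -> R) &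
      forall t, ~ D t -> w t = 0].

Section Objects.
Context {R : realType}.
Implicit Types (W : weights R) (P Q : nat -> {poly R[i]}) (s : nat -> R[i]).

(* The bilinear form <f, g> (no complex conjugation). *)
Definition bracket W (f g : R -> R[i]) : R[i] :=
  cintegral leb2 (S1 W `*` S2 W)
    (fun u => (w1 W u.1 * w2 W u.2 / (u.1 + u.2))%:C * f u.1 * g u.2).

Definition int1 W (f : R -> R[i]) : R[i] :=
  cintegral leb (S1 W) (fun t => (w1 W t)%:C * f t).

Definition int2 W (f : R -> R[i]) : R[i] :=
  cintegral leb (S2 W) (fun t => (w2 W t)%:C * f t).

Definition finite_moments W : Prop := forall j k : nat,
  (@leb2 R).-integrable (S1 W `*` S2 W)
    (fun u => (w1 W u.1 * w2 W u.2 / (u.1 + u.2) * u.1 ^+ j * u.2 ^+ k)%:E).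

Definition moment W (j k : nat) : R[i] :=
  bracket W (fun x => x%:C ^+ j) (fun y => y%:C ^+ k).

Definition Z W (n : nat) : R[i] := \det (\matrix_(j < n, k < n) moment W j k).

(* Evaluation at a real point. *)
Definition at_real (p : {poly R[i]}) : R -> R[i] := fun t => p.[t%:C].

Definition biorthonormal W P Q s : Prop :=
  [/\ forall n, size (P n) = n.+1 /\ size (Q n) = n.+1,
      forall n, lead_coef (P n) = s n /\ lead_coef (Q n) = s n,
      forall n, s n ^+ 2 = Z W n / Z W n.+1 &
      forall m n, bracket W (at_real (P m)) (at_real (Q n)) = (m == n)%:R].

Definition pi_ W P (n : nat) : R[i] := int1 W (at_real (P n)).
Definition eta_ W Q (n : nat) : R[i] := int2 W (at_real (Q n)).

Definition generic W P Q : Prop :=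
  [/\ finite_moments W, forall n, Z W n != 0,
      forall n, pi_ W P n != 0 & forall n, eta_ W Q n != 0].

Definition X_ W P Q (n : nat) : R[i] :=
  bracket W (fun x => x%:C * at_real (P n) x) (at_real (Q n)).
Definition Y_ W P Q (n : nat) : R[i] :=
  bracket W (at_real (P n)) (fun y => y%:C * at_real (Q n) y).

Definition hatP W P Q (n : nat) : {poly R[i]} :=
  - \sum_(k < n.+1) eta_ W Q k *: P k.
Definition checkQ W P Q (n : nat) : {poly R[i]} :=
  - \sum_(j < n.+1) pi_ W P j *: Q j.

(* The term of index n - 1, with the convention that index -1 gives 0. *)
Definition pred_term {V : nmodType} (a : nat -> V) (n : nat) : V :=
  if n is m.+1 then a m else 0.

(* P_n^(mu) and Q_n^(nu); only the orders 0, 1, 2 are used. *)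
Definition Pfun W P (mu n : nat) (z : R[i]) : R[i] :=
  match mu with
  | 0 => (P n).[z]
  | 1 => int1 W (fun x => at_real (P n) x / (z - x%:C))
  | _ => bracket W (fun x => at_real (P n) x / (z - x%:C)) (fun=> 1)
  end.

Definition Qfun W Q (nu n : nat) (z : R[i]) : R[i] :=
  match nu with
  | 0 => (Q n).[z]
  | 1 => int2 W (fun y => at_real (Q n) y / (z - y%:C))
  | _ => bracket W (fun=> 1) (fun y => at_real (Q n) y / (z - y%:C))
  end.

Definition f1 W (z : R[i]) : R[i] := int1 W (fun x => (z - x%:C)^-1).
Definition f2 W (z : R[i]) : R[i] := int2 W (fun y => (z - y%:C)^-1).
Definition g1 W (z : R[i]) : R[i] :=
  bracket W (fun x => (z - x%:C)^-1) (fun=> 1).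
Definition g2 W (z : R[i]) : R[i] :=
  bracket W (fun=> 1) (fun y => (z - y%:C)^-1).

Definition cterm W (mu nu : nat) (x y : R[i]) : R[i] :=
  match mu, nu with
  | 0, 0 | 0, 1 | 1, 0 => 0
  | 1, 1 => (x + y)^-1
  | 0, _ | _, 0 => - (x + y)^-1
  | 1, _ => - (f1 W x / (x + y))
  | _, 1 => - (f2 W y / (x + y))
  | _, _ => - ((g1 W x + g2 W y) / (x + y))
  end.

Definition CDkernel W P Q (mu nu n : nat) (x y : R[i]) : R[i] :=
  \sum_(l < n.+1) Pfun W P mu l x * Qfun W Q nu l y + cterm W mu nu x y.

(* Where a function of order mu is defined: the whole plane for the polynomials
   (mu = 0), the complement of the closed support D for the transforms. *)
Definition in_dom (D : set R) (mu : nat) (z : R[i]) : Prop :=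
  (0 < mu)%N -> forall t : R, closure D t -> z != t%:C.

Definition mx3 (rows : seq (seq R[i])) : 'M[R[i]]_3 :=
  \matrix_(i < 3, j < 3) nth 0 (nth [::] rows i) j.

Definition col3 (a b c : R[i]) : 'cV[R[i]]_3 :=
  \col_(i < 3) nth 0 [:: a; b; c] i.

Definition window (a : nat -> R[i]) (n : nat) : 'cV[R[i]]_3 :=
  col3 (a n.+1) (a n) (pred_term a n).

Definition Pvec W P (mu n : nat) (x : R[i]) : 'cV[R[i]]_3 :=
  window (fun k => Pfun W P mu k x) n.
Definition Qvec W Q (nu n : nat) (y : R[i]) : 'cV[R[i]]_3 :=
  window (fun k => Qfun W Q nu k y) n.

Definition G W P Q s (n : nat) (x y : R[i]) : 'M[R[i]]_3 :=
  let X := X_ W P Q n in let Y := Y_ W P Q n in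
  let sm := pred_term s n in let s0 := s n in let sp := s n.+1 in
  mx3 [:: [:: s0 ^+ 2 / sp ^+ 2; s0 / sp * (Y - y); - (sm / sp)];
          [:: s0 / sp * (X - x); (X + y) * (Y + x); sm / s0 * (Y + x)];
          [:: - (sm / sp); sm / s0 * (X + y); sm ^+ 2 / s0 ^+ 2]].

Definition Ginv W P Q s (n : nat) (x y : R[i]) : 'M[R[i]]_3 :=
  let X := X_ W P Q n in let Y := Y_ W P Q n in
  let sm := pred_term s n in let s0 := s n in let sp := s n.+1 in
  mx3 [:: [:: 0; sp / s0; - (sp / sm * (Y + x))];
          [:: sp / s0; 0; s0 / sm];
          [:: - (sp / sm * (X + y)); s0 / sm;
              - (s0 ^+ 2 / sm ^+ 2 * (x + y))]].

(* u^T A v, as a scalar. *)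
Definition bilin (A : 'M[R[i]]_3) (u v : 'cV[R[i]]_3) : R[i] :=
  (u^T *m A *m v) 0 0.

(* Coefficients of P_{n+1}, P_n, P_{n-1} in pi_n hatP_n(x), and of Q_{n+1}, Q_n,
   Q_{n-1} in eta_n checkQ_n(y). *)
Definition comp_hatP W P Q s (n : nat) (x : R[i]) : 'cV[R[i]]_3 :=
  col3 (s n / s n.+1) (- (Y_ W P Q n + x)) (- (pred_term s n / s n)).
Definition comp_checkQ W P Q s (n : nat) (y : R[i]) : 'cV[R[i]]_3 :=
  col3 (s n / s n.+1) (- (X_ W P Q n + y)) (- (pred_term s n / s n)).

End Objects.

(* Main.v *)
Require Import Defs.
From HB Require Import structures.
From mathcomp Require Import all_boot all_order all_algebra.
From mathcomp Require Import all_classical all_reals all_analysis.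
From mathcomp Require Import measurable_realfun ring lra.

(* Since (x + y) / (x + y) = 1 almost everywhere, Fubini gives
   <x f, g> + <f, y g> = (int w1 f) (int w2 g): in the biorthogonal bases,
   multiplication by x plus multiplication by y is the rank-one matrix
   (pi_m eta_n).  Expanding x P_m therefore gives a three-term relation plus the
   term pi_m (sum_(k <= m) eta_k P_k).  A functional L with
   L(x p) = z L(p) - l(p), such as evaluation at z or a Cauchy transform,
   transports this relation to the sequence L(P_n), up to the defect l(P_n).
   Multiplying the relations for P and Q crosswise and summing telescopes into a
   Christoffel-Darboux identity whose boundary terms are the c^{mu,nu}; the
   remaining sums are eliminated by the relations themselves, and the result is
   the form G_n in the windows of length 3. *)

Set Implicit Arguments.
Unset Strict Implicit.
Unset Printing Implicit Defensive.

Import Order.TTheory GRing.Theory Num.Theory.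
Import numFieldNormedType.Exports.
Local Open Scope classical_set_scope.
Local Open Scope ring_scope.
Local Open Scope complex_scope.

(** * Complex-valued integrals *)

Section ComplexIntegral.
Context {d : measure_display} {T : measurableType d} {R : realType}.
Variables (mu : {measure set T -> \bar R}) (D : set T) (mD : measurable D).
Implicit Types (f g : T -> R[i]) (c : R[i]).

(** Componentwise, to match [cintegral]; complex linearity is then reduced to real linearity of each
    component. *)
Definition cintegrable f : Prop :=
  mu.-integrable D (EFin \o (@complex.Re R \o f)) /\
  mu.-integrable D (EFin \o (@complex.Im R \o f)).

Lemma eq_cintegrable f g : {in D, f =1 g} -> cintegrable f -> cintegrable g.
Proof.
move=> fg [iR iI]; split; [apply: eq_integrable iR|apply: eq_integrable iI] => //;
  by move=> t tD /=; rewrite fg.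
Qed.

Lemma eq_cintegral f g : {in D, f =1 g} -> cintegral mu D f = cintegral mu D g.
Proof. by move=> fg; congr Complex; apply: eq_Rintegral => t /fg ->. Qed.

Lemma cintegrable_real (r : T -> R) :
  mu.-integrable D (EFin \o r) -> cintegrable (fun t => (r t)%:C).
Proof. by split=> //; exact: integrable0. Qed.

Lemma cintegral_real (r : T -> R) :
  cintegral mu D (fun t => (r t)%:C) = (\int[mu]_(t in D) r t)%:C.
Proof.
by rewrite /cintegral /=; congr Complex; rewrite /Rintegral integral0.
Qed.

Lemma cintegrableD f g :
  cintegrable f -> cintegrable g -> cintegrable (fun t => f t + g t).
Proof.
move=> [fR fI] [gR gI]; split.
  apply: eq_integrable (integrableD mD fR gR) => //.
  by move=> t _ /=; case: (f t) (g t) => ? ? [].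
apply: eq_integrable (integrableD mD fI gI) => //.
by move=> t _ /=; case: (f t) (g t) => ? ? [].
Qed.

Lemma cintegralD f g : cintegrable f -> cintegrable g ->
  cintegral mu D (fun t => f t + g t) = cintegral mu D f + cintegral mu D g.
Proof.
move=> [fR fI] [gR gI]; rewrite /cintegral; apply/eqP; rewrite eq_complex /=.
by rewrite -!RintegralD //; apply/andP; split; apply/eqP; apply: eq_Rintegral => t _;
  case: (f t) (g t) => ? ? [].
Qed.

Lemma cintegrableZ c f : cintegrable f -> cintegrable (fun t => c * f t).
Proof.
case: c => a b [fR fI]; split.
  have ab := integrableB mD (integrableZl mD a fR) (integrableZl mD b fI).
  apply: eq_integrable ab => //.
  by move=> t _ /=; case: (f t).
have ab := integrableD mD (integrableZl mD a fI) (integrableZl mD b fR).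
apply: eq_integrable ab => //.
by move=> t _ /=; case: (f t) => u v /=.
Qed.

Lemma cintegralZ c f : cintegrable f ->
  cintegral mu D (fun t => c * f t) = c * cintegral mu D f.
Proof.
case: c => a b [fR fI]; rewrite /cintegral; apply/eqP; rewrite eq_complex /=.
have aR := integrableZl mD a fR; have bR := integrableZl mD b fR.
have aI := integrableZl mD a fI; have bI := integrableZl mD b fI.
by rewrite -!RintegralZl // -RintegralB // -RintegralD //;
  apply/andP; split; apply/eqP; apply: eq_Rintegral => t _; case: (f t).
Qed.

(** Horner induction with [h] kept general: a factor ['X] is absorbed into the weight as [h * phi],
    whose moments are those of [h] shifted by one. *)
Lemma cintegrable_poly (h phi : T -> R[i]) (p : {poly R[i]}) :
  (forall j : nat, cintegrable (fun t => h t * phi t ^+ j)) ->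
  cintegrable (fun t => h t * p.[phi t]).
Proof.
elim/poly_ind: p h => [|p c IH] h hh.
  by apply: eq_cintegrable (cintegrableZ 0 (hh 0)) => t _; rewrite horner0 mulr0 mul0r.
have hphi j : cintegrable (fun t => (h t * phi t) * phi t ^+ j).
  by apply: eq_cintegrable (hh j.+1) => t _; rewrite exprS mulrA.
apply: eq_cintegrable (cintegrableD (IH _ hphi) (cintegrableZ c (hh 0))) => t _.
by rewrite hornerMXaddC expr0; ring.
Qed.

Lemma cintegral_poly_scalar (h phi : T -> R[i]) :
  (forall j : nat, cintegrable (fun t => h t * phi t ^+ j)) ->
  scalar (fun p : {poly R[i]} => cintegral mu D (fun t => h t * p.[phi t])).
Proof.
move=> hh c p q /=; rewrite -cintegralZ; last exact: cintegrable_poly.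
rewrite -cintegralD; [|exact/cintegrableZ/cintegrable_poly|exact: cintegrable_poly].
by apply: eq_cintegral => t _; rewrite hornerD hornerZ; ring.
Qed.

Lemma cintegrableM_bounded (r : T -> R) (h : T -> R[i]) (M : R) :
  mu.-integrable D (EFin \o r) ->
  measurable_fun D (@complex.Re R \o h) -> measurable_fun D (@complex.Im R \o h) ->
  (forall t, D t -> `|complex.Re (h t)| <= M /\ `|complex.Im (h t)| <= M) ->
  cintegrable (fun t => (r t)%:C * h t).
Proof.
move=> ir mR mI hM.
have bnd (g : T -> R) : (forall t, D t -> `|g t| <= M) -> [bounded g t | t in D].
  by move=> gM; exists M; split=> [|N MN t Dt]; [exact: num_real|
    exact: le_trans (gM t Dt) (ltW MN)].
split.
  apply: eq_integrable (integrableMl mD ir mR (bnd _ _)) => //.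
    by move=> t _ /=; case: (h t) => u v; rewrite /= mul0r subr0.
  by move=> t /hM[].
apply: eq_integrable (integrableMl mD ir mI (bnd _ _)) => //.
  by move=> t _ /=; case: (h t) => u v; rewrite /= mul0r addr0.
by move=> t /hM[].
Qed.

End ComplexIntegral.

(** * Measurability and boundedness of the resolvent [t |-> 1 / (z - t)] *)

Section Resolvent.
Context {R : realType}.
Implicit Types (z : R[i]) (t : R).

Lemma measurable_invr : measurable_fun [set: R] (GRing.inv : R -> R).
Proof.
rewrite (_ : [set: R] = [set 0] `|` ~` [set 0]); last by rewrite setUv.
apply/measurable_funU; [by []|exact: measurableC|split].
  by apply: measurable_fun_set1.
apply: open_continuous_measurable_fun; first exact/closed_openC/closed_eq.
by move=> t; rewrite inE /= => /eqP t0; exact: inv_continuous.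
Qed.

Lemma resolventE z t : (z - t%:C)^-1 =
  ((complex.Re z - t) / ((complex.Re z - t) ^+ 2 + complex.Im z ^+ 2)) +i*
  (- complex.Im z / ((complex.Re z - t) ^+ 2 + complex.Im z ^+ 2)).
Proof. by case: z => a b; apply/eqP; rewrite eq_complex /= subr0 mulNr !eqxx. Qed.

Lemma measurable_resolvent z :
  measurable_fun [set: R] (fun t => complex.Re (z - t%:C)^-1) /\
  measurable_fun [set: R] (fun t => complex.Im (z - t%:C)^-1).
Proof.
have md : measurable_fun [set: R]
    (fun t => ((complex.Re z - t) ^+ 2 + complex.Im z ^+ 2)^-1).
  apply: (measurableT_comp measurable_invr); apply: measurable_funD => //.
  by apply: measurable_funX; exact: measurable_funB.
split; under eq_fun do rewrite resolventE /=; apply: measurable_funM => //.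
exact: measurable_funB.
Qed.

(** The squared distance from [z] to [D] is bounded below: by [Im z ^ 2] off the real axis, and on
    the axis because [z] avoids the closure of [D]. *)
Lemma resolvent_bounded (D : set R) z : in_dom D 1 z ->
  exists M : R, forall t, D t ->
    `|complex.Re (z - t%:C)^-1| <= M /\ `|complex.Im (z - t%:C)^-1| <= M.
Proof.
move=> /(_ isT) zD.
have [e e0 He] : exists2 e : R, 0 < e &
    forall t, D t -> e <= (complex.Re z - t) ^+ 2 + complex.Im z ^+ 2.
  have [b0|b0] := eqVneq (complex.Im z) 0; last first.
    exists (complex.Im z ^+ 2); first by rewrite exprn_even_gt0.
    by move=> t _; rewrite lerDr sqr_ge0.
  have : ~ closure D (complex.Re z).
    by move=> /zD /eqP; apply; case: (z) b0 => a b /= ->.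
  move/existsNP => [B /not_implyP[/nbhs_ballP[e /= e0 eB] /set0P/negP/negPn/eqP DB0]].
  exists (e ^+ 2); first exact: exprn_gt0.
  move=> t Dt; rewrite b0 expr0n addr0 -(real_normK (num_real (_ - _))).
  rewrite ler_pXn2r ?nnegrE ?normr_ge0 //; last exact: ltW.
  rewrite leNgt; apply/negP => te.
  suff : (D `&` B) t by rewrite DB0.
  by split=> //; apply: eB.
(* Each component is [c / N] with [c^2 <= N] and [e <= N]; since [|c| <= 1 + c^2], its modulus is at
   most [1 / N + 1 <= 1 / e + 1]. *)
exists (1 + e^-1) => t Dt; rewrite resolventE /=; have := He t Dt.
set a := _ - t; set b := complex.Im z => eN.
have N0 := lt_le_trans e0 eN.
have bnd c : c ^+ 2 <= a ^+ 2 + b ^+ 2 ->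
    `|c / (a ^+ 2 + b ^+ 2)| <= 1 + e^-1.
  move=> cN; rewrite normrM normfV (gtr0_norm N0) ler_pdivrMr //.
  have : 1 <= e^-1 * (a ^+ 2 + b ^+ 2) by rewrite ler_pdivlMl ?mulr1.
  have : `|c| <= 1 + c ^+ 2.
    by rewrite -(real_normK (num_real c)); have := sqr_ge0 (`|c| - 1); nra.
  lra.
by split; apply: bnd; rewrite ?sqrrN ?lerDl ?lerDr sqr_ge0.
Qed.

End Resolvent.

(** * Moments *)

(** Tonelli's criterion: integrability for either product measure is finiteness of the same iterated
    integral of [|f|]. *)
Lemma integrable_swap (d1 d2 : measure_display) (T1 : measurableType d1)
    (T2 : measurableType d2) (R : realType)
    (m1 : {sigma_finite_measure set T1 -> \bar R})
    (m2 : {sigma_finite_measure set T2 -> \bar R}) (f : T1 * T2 -> \bar R) :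
  (m1 \x m2)%E.-integrable setT f ->
  (m2 \x m1)%E.-integrable setT (fun u => f (u.2, u.1)).
Proof.
move=> fi; have mf := measurable_int _ fi.
apply/(integrable12ltyP m2 m1).
  apply: (measurableT_comp mf); apply/measurable_fun_pairP.
  by split; [exact: measurable_snd|exact: measurable_fst].
exact/(integrable21ltyP m1 m2).
Qed.

Section Moments.
Context {R : realType}.
Implicit Types (W : weights R).

Definition wkernel W (j k : nat) (u : R * R) : R :=
  w1 W u.1 * w2 W u.2 / (u.1 + u.2) * u.1 ^+ j * u.2 ^+ k.

(** The densities vanish off their supports, so integrals over [S1 x S2] become integrals over the
    whole plane, where Fubini applies directly. *)
Lemma wkernel_restrict W j k :
  is_density (S1 W) (w1 W) -> is_density (S2 W) (w2 W) ->
  wkernel W j k \_ (S1 W `*` S2 W) = wkernel W j k.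
Proof.
move=> [_ _ _ v1] [_ _ _ v2]; apply/funext => -[x y]; rewrite patchE.
case: ifPn => //; rewrite notin_setE /= /wkernel /=.
have [Sx|/v1 ->] := pselect (S1 W x); last by rewrite !mul0r.
have [Sy|/v2 ->] := pselect (S2 W y); last by rewrite mulr0 !mul0r.
by move=> [].
Qed.

Lemma integrable_wkernelT W j k :
  is_density (S1 W) (w1 W) -> is_density (S2 W) (w2 W) -> finite_moments W ->
  (@leb2 R).-integrable setT (EFin \o wkernel W j k).
Proof.
move=> d1 d2 fm; have [m1 _ _ _] := d1; have [m2 _ _ _] := d2.
have := (integrable_mkcond _ (measurableX m1 m2)).1 (fm j k).
rewrite -[X in X \_ _]/(EFin \o wkernel W j k) restrict_EFin.
by rewrite wkernel_restrict.
Qed.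

Lemma momentE W j k :
  moment W j k = (\int[leb2]_(u in S1 W `*` S2 W) wkernel W j k u)%:C.
Proof.
rewrite -cintegral_real; apply: eq_cintegral => u _.
by rewrite /wkernel ![in RHS]rmorphM /= !rmorphXn !rmorphM.
Qed.

Lemma Rintegral_wkernelT W j k :
  is_density (S1 W) (w1 W) -> is_density (S2 W) (w2 W) ->
  \int[leb2]_(u in S1 W `*` S2 W) wkernel W j k u =
  \int[leb2]_u wkernel W j k u.
Proof. by move=> d1 d2; rewrite Rintegral_mkcond wkernel_restrict. Qed.

Definition swap_weights W := Weights (S2 W) (S1 W) (w2 W) (w1 W).

Lemma wkernel_swap W j k u :
  wkernel (swap_weights W) j k u = wkernel W k j (u.2, u.1).
Proof. by case: u => x y; rewrite /wkernel /= [y + x]addrC; ring. Qed.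

Lemma finite_moments_swap W :
  is_density (S1 W) (w1 W) -> is_density (S2 W) (w2 W) -> finite_moments W ->
  finite_moments (swap_weights W).
Proof.
move=> d1 d2 fm j k; have [m1 _ _ _] := d1; have [m2 _ _ _] := d2.
have mS := measurableX m2 m1.
have := integrable_swap (m1 := lebesgue_measure) (m2 := lebesgue_measure)
  (integrable_wkernelT k j d1 d2 fm).
move=> /(integrableS measurableT mS (@subsetT _ _)).
by apply: (eq_integrable mS) => u _; rewrite /= -wkernel_swap.
Qed.

Lemma ae_neq0 : {ae @lebesgue_measure R, forall y : R, y != 0}.
Proof.
exists [set 0]; split=> //; first exact: lebesgue_measure_set1.
by move=> y /= /negP; rewrite negbK => /eqP.
Qed.

(** Slices are taken over the whole line, where [x + y] may vanish. Nonzero weights force both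
    points into the supports, hence to be nonnegative, and [y != 0] then makes the sum positive. *)
Lemma weights_add_neq0 W x y :
  is_density (S1 W) (w1 W) -> is_density (S2 W) (w2 W) ->
  y != 0 -> w1 W x != 0 -> w2 W y != 0 -> x + y != 0.
Proof.
move=> [_ p1 _ v1] [_ p2 _ v2] yn0 wx wy.
have x0 : 0 <= x by apply: p1; apply: contrapT => /v1/eqP; exact/negP.
have y0 : 0 <= y by apply: p2; apply: contrapT => /v2/eqP; exact/negP.
by rewrite gt_eqF // ltr_wpDl // lt_def yn0.
Qed.

(* For almost every y the slice x |-> w1 x * w2 y * x^j / (x + y) is integrable;
   a nonzero moment yields such a y with w2 y != 0, and multiplying the slice
   by x + y clears the denominator. *)
Lemma integrable_weight1 W (j : nat) :
  is_density (S1 W) (w1 W) -> is_density (S2 W) (w2 W) -> finite_moments W ->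
  moment W 0 0 != 0 ->
  (@leb R).-integrable setT (fun x => (w1 W x * x ^+ j)%:E).
Proof.
move=> d1 d2 fm; apply: contra_neqP => nint.
rewrite momentE Rintegral_wkernelT // /Rintegral.
have i00 := integrable_wkernelT 0 0 d1 d2 fm.
have ij := integrable_wkernelT j 0 d1 d2 fm.
have ij1 := integrable_wkernelT j.+1 0 d1 d2 fm.
rewrite -(integral21_prod_meas1 (m1 := leb) (m2 := leb)) //.
rewrite (_ : (\int[_]_y _)%E = 0%E) //.
(* By contraposition: if [w1 x * x^j] is not integrable, then [w2 y = 0] for almost every [y], so
   almost every slice of the zeroth moment integrates to zero. *)
rewrite (ae_eq_integral (cst 0%E)) ?integral0 //.
  exact: (measurable_fubini_G (m1 := lebesgue_measure) (m2 := lebesgue_measure)).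
have := ae_integrable2 (m1 := lebesgue_measure) (m2 := lebesgue_measure) ij.
have := ae_integrable2 (m1 := lebesgue_measure) (m2 := lebesgue_measure) ij1.
apply: filterS3 ae_neq0; first exact: (ae_filter_ringOfSetsType lebesgue_measure).
move=> y yn0 iy1 iy _ /=; rewrite /fubini_G.
have [wy|wy] := eqVneq (w2 W y) 0.
  by apply: integral0_eq => x _; rewrite /= /wkernel /= wy mulr0 !mul0r.
case: nint; apply: eq_integrable (integrableZl _ (w2 W y)^-1
  (integrableD _ iy1 (integrableZl _ y iy))) => // x _ /=.
rewrite -[LHS]/((w2 W y)^-1 * (wkernel W j.+1 0 (x, y) + y * wkernel W j 0 (x, y)))%:E.
rewrite /wkernel /= expr0 !mulr1; congr EFin.
have [wx|wx] := eqVneq (w1 W x) 0; first by rewrite wx !mul0r mulr0 addr0 mulr0.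
have xy0 := weights_add_neq0 d1 d2 yn0 wx wy.
by rewrite exprS; field; rewrite xy0 wy.
Qed.

Lemma moment_swap W j k :
  is_density (S1 W) (w1 W) -> is_density (S2 W) (w2 W) -> finite_moments W ->
  moment (swap_weights W) j k = moment W k j.
Proof.
move=> d1 d2 fm; have ik := integrable_wkernelT k j d1 d2 fm.
have fm' := finite_moments_swap d1 d2 fm.
have ik2 := integrable_wkernelT (W := swap_weights W) j k d2 d1 fm'.
rewrite !momentE !Rintegral_wkernelT //; congr (_%:C); congr fine.
rewrite -(integral21_prod_meas1 (m1 := lebesgue_measure) (m2 := lebesgue_measure)) //.
rewrite -(integral12_prod_meas1 (m1 := lebesgue_measure) (m2 := lebesgue_measure)) //.
rewrite /fubini_F /fubini_G.
by under eq_integral do under eq_integral do rewrite wkernel_swap.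
Qed.

Lemma integrable_weight2 W (k : nat) :
  is_density (S1 W) (w1 W) -> is_density (S2 W) (w2 W) -> finite_moments W ->
  moment W 0 0 != 0 ->
  (@leb R).-integrable setT (fun y => (w2 W y * y ^+ k)%:E).
Proof.
move=> d1 d2 fm; rewrite -moment_swap // => m0.
have fm' := finite_moments_swap d1 d2 fm.
exact: (integrable_weight1 (W := swap_weights W) k d2 d1 fm' m0).
Qed.

(** Integrating first in [x] at a fixed [y != 0], the two kernels add up to
    [w1 x * x^j * w2 y * y^k], because [(x + y) / (x + y) = 1] wherever both weights are nonzero. *)
Lemma moment_add W (j k : nat) :
  is_density (S1 W) (w1 W) -> is_density (S2 W) (w2 W) -> finite_moments W ->
  moment W 0 0 != 0 ->
  moment W j.+1 k + moment W j k.+1 =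
  (\int[leb]_x (w1 W x * x ^+ j))%:C * (\int[leb]_y (w2 W y * y ^+ k))%:C.
Proof.
move=> d1 d2 fm m0; have i1 := integrable_weight1 j d1 d2 fm m0.
have i2 := integrable_weight2 k d1 d2 fm m0.
have ij := integrable_wkernelT j.+1 k d1 d2 fm.
have ik := integrable_wkernelT j k.+1 d1 d2 fm.
rewrite !momentE !Rintegral_wkernelT // -rmorphM -rmorphD; congr (_%:C).
rewrite -RintegralD // mulrC -RintegralZr // /Rintegral; congr fine.
have iD := integrableD measurableT ij ik.
rewrite -(integral21_prod_meas1 (m1 := lebesgue_measure) (m2 := lebesgue_measure)) //.
apply: ae_eq_integral => //.
- exact: (measurable_fubini_G (m1 := lebesgue_measure) (m2 := lebesgue_measure)).
- exact: measurable_int (integrableZr _ _ i2).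
apply: filterS ae_neq0; first exact: (ae_filter_ringOfSetsType lebesgue_measure).
move=> y yn0 _; rewrite /fubini_G EFinM fineK ?integrable_fin_num //.
rewrite -integralZl //; apply: eq_integral => x _.
rewrite -[LHS]/(wkernel W j.+1 k (x, y) + wkernel W j k.+1 (x, y))%:E.
rewrite -EFinM /wkernel /=; congr EFin.
have [->|wx] := eqVneq (w1 W x) 0; first by rewrite !mul0r mulr0 addr0.
have [->|wy] := eqVneq (w2 W y) 0; first by rewrite !(mulr0, mul0r) addr0.
have xy0 := weights_add_neq0 d1 d2 yn0 wx wy.
by rewrite !exprS; field.
Qed.

End Moments.

(** * Integral functionals on polynomials *)

Section PolyFunctional.
Context {d : measure_display} {T : measurableType d} {R : realType}.
Variables (mu : {measure set T -> \bar R}) (D : set T) (mD : measurable D).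
Variables (r phi : T -> R).
Hypothesis mom : forall j : nat, mu.-integrable D (fun t => (r t * phi t ^+ j)%:E).

(** The weight [r] and the coordinate [phi] live on an arbitrary measure space: [phi = id] yields
    the single integrals, [phi = fst] or [snd] the double ones. *)
Definition poly_integral (p : {poly R[i]}) : R[i] :=
  cintegral mu D (fun t => (r t)%:C * p.[(phi t)%:C]).

Definition cauchy_integral (z : R[i]) (p : {poly R[i]}) : R[i] :=
  cintegral mu D (fun t => (r t)%:C * (p.[(phi t)%:C] / (z - (phi t)%:C))).

Lemma cintegrable_weight (j : nat) :
  cintegrable mu D (fun t => (r t)%:C * (phi t)%:C ^+ j).
Proof.
apply: (eq_cintegrable mD) (cintegrable_real (mom j)) => t _.
by rewrite rmorphM rmorphXn.
Qed.

Lemma poly_integral_scalar : scalar poly_integral.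
Proof. exact: (cintegral_poly_scalar mD cintegrable_weight). Qed.

Variables (S : set R) (z : R[i]).
Hypotheses (mphi : measurable_fun D phi) (phiS : forall t, D t -> S (phi t)).
Hypothesis zS : in_dom S 1 z.

Lemma cintegrable_resolvent (j : nat) :
  cintegrable mu D (fun t => (r t)%:C / (z - (phi t)%:C) * (phi t)%:C ^+ j).
Proof.
have [M HM] := resolvent_bounded zS.
have [mR mI] := measurable_resolvent z.
have := cintegrableM_bounded mD (h := fun t => (z - (phi t)%:C)^-1) (mom j)
  (measurableT_comp mR mphi) (measurableT_comp mI mphi)
  (fun t Dt => HM _ (phiS Dt)).
by apply: (eq_cintegrable mD) => t _; rewrite rmorphM rmorphXn mulrAC.
Qed.

Lemma cauchy_integralE (p : {poly R[i]}) : cauchy_integral z p =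
  cintegral mu D (fun t => (r t)%:C / (z - (phi t)%:C) * p.[(phi t)%:C]).
Proof. by apply: eq_cintegral => t _; rewrite mulrA mulrAC. Qed.

Lemma cauchy_integral_scalar : scalar (cauchy_integral z).
Proof.
move=> c p q; rewrite !cauchy_integralE.
exact: (cintegral_poly_scalar mD cintegrable_resolvent).
Qed.

(** Integrate [t / (z - t) = z / (z - t) - 1], valid since [z] lies off the closure of [S]. *)
Lemma cauchy_integralX (p : {poly R[i]}) :
  cauchy_integral z ('X * p) = z * cauchy_integral z p - poly_integral p.
Proof.
rewrite !cauchy_integralE -mulN1r /poly_integral.
have iz := cintegrable_poly mD p cintegrable_resolvent.
have ip := cintegrable_poly mD p cintegrable_weight.
rewrite -(cintegralZ mD _ iz) -(cintegralZ mD _ ip).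
rewrite -(cintegralD mD (cintegrableZ mD _ iz) (cintegrableZ mD _ ip)).
apply: eq_cintegral => t; rewrite inE => Dt.
have z0 : z - (phi t)%:C != 0.
  by rewrite subr_eq0; apply: (zS isT); exact/subset_closure/phiS.
by rewrite hornerM hornerX; field.
Qed.

End PolyFunctional.

Lemma is_scalarD (A : pzRingType) (V : lmodType A) (f : V -> A) :
  scalar f -> {morph f : u v / u + v}.
Proof. by move=> fL u v; rewrite -{1}[u]scale1r fL mul1r. Qed.

Lemma is_scalarZ (A : pzRingType) (V : lmodType A) (f : V -> A) :
  scalar f -> forall a u, f (a *: u) = a * f u.
Proof.
move=> fL a u; have f0 : f 0 = 0.
  by apply: (addrI (f 0)); rewrite -(is_scalarD fL) !addr0.
by rewrite -[a *: u]addr0 fL f0 addr0.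
Qed.

Lemma is_scalar_sum (A : pzRingType) (V : lmodType A) (f : V -> A) (I : Type)
    (s : seq I) (Pr : pred I) (c : I -> A) (v : I -> V) :
  scalar f ->
  f (\sum_(i <- s | Pr i) c i *: v i) = \sum_(i <- s | Pr i) c i * f (v i).
Proof.
move=> fL; have f0 : f 0 = 0 by rewrite -[0](scale0r 0) (is_scalarZ fL) mul0r.
by elim/big_rec2: _ => // i _ u _ <-; rewrite fL.
Qed.

Lemma scalar_poly_ext (A : comNzRingType) (f g : {poly A} -> A) :
  scalar f -> scalar g -> (forall j, f 'X^j = g 'X^j) -> f =1 g.
Proof.
move=> fL gL fg p; rewrite -[p]coefK poly_def !is_scalar_sum //.
by apply: eq_bigr => i _; rewrite fg.
Qed.

Lemma int1_Xn (R : realType) (W : weights R) (j : nat) :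
  is_density (S1 W) (w1 W) ->
  int1 W (at_real 'X^j) = (\int[leb]_x (w1 W x * x ^+ j))%:C.
Proof.
move=> [_ _ _ v1].
transitivity (cintegral leb (S1 W) (fun x => (w1 W x * x ^+ j)%:C)).
  by apply: eq_cintegral => x _; rewrite /at_real hornerXn rmorphM rmorphXn.
rewrite cintegral_real Rintegral_mkcond; congr (_%:C); apply: eq_Rintegral => x _.
by rewrite patchE; case: ifPn => //; rewrite notin_setE => /v1 ->; rewrite mul0r.
Qed.

Lemma int2_Xn (R : realType) (W : weights R) (k : nat) :
  is_density (S2 W) (w2 W) ->
  int2 W (at_real 'X^k) = (\int[leb]_y (w2 W y * y ^+ k))%:C.
Proof. exact: (int1_Xn (W := swap_weights W)). Qed.

Section WeightFunctionals.
Context {R : realType}.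
Variable W : weights R.
Hypotheses (dens1 : is_density (S1 W) (w1 W)) (dens2 : is_density (S2 W) (w2 W)).
Hypotheses (fm : finite_moments W) (m00 : moment W 0 0 != 0).

Let mS : measurable (S1 W `*` S2 W).
Proof. by have [m1 _ _ _] := dens1; have [m2 _ _ _] := dens2; exact: measurableX. Qed.

Definition polybracket (p q : {poly R[i]}) : R[i] :=
  bracket W (at_real p) (at_real q).

Let cint (j k : nat) : cintegrable leb2 (S1 W `*` S2 W) (fun u =>
  (w1 W u.1 * w2 W u.2 / (u.1 + u.2))%:C * u.1%:C ^+ j * u.2%:C ^+ k).
Proof.
apply: (eq_cintegrable (mu := leb2) mS) (cintegrable_real (fm j k)) => u _.
by rewrite ![in LHS]rmorphM /= !rmorphXn !rmorphM.
Qed.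

Lemma polybracket_scalarl (q : {poly R[i]}) : scalar (polybracket^~ q).
Proof.
have iq j : cintegrable leb2 (S1 W `*` S2 W) (fun u =>
    (w1 W u.1 * w2 W u.2 / (u.1 + u.2))%:C * q.[u.2%:C] * u.1%:C ^+ j).
  have iqj := cintegrable_poly (mu := leb2) mS q (cint j).
  by apply: (eq_cintegrable (mu := leb2) mS) iqj => u _; ring.
move=> c p p'; rewrite -[in RHS]/(polybracket _ _).
have E x : polybracket x q = cintegral leb2 (S1 W `*` S2 W) (fun u =>
    (w1 W u.1 * w2 W u.2 / (u.1 + u.2))%:C * q.[u.2%:C] * x.[u.1%:C]).
  by apply: eq_cintegral => u _; rewrite mulrAC.
by rewrite /= !E; exact: (cintegral_poly_scalar (mu := leb2) mS iq).
Qed.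

Lemma polybracket_scalarr (p : {poly R[i]}) : scalar (polybracket p).
Proof.
have ip k : cintegrable leb2 (S1 W `*` S2 W) (fun u =>
    (w1 W u.1 * w2 W u.2 / (u.1 + u.2))%:C * p.[u.1%:C] * u.2%:C ^+ k).
  have ik j : cintegrable leb2 (S1 W `*` S2 W) (fun u =>
      (w1 W u.1 * w2 W u.2 / (u.1 + u.2))%:C * u.2%:C ^+ k * u.1%:C ^+ j).
    by apply: (eq_cintegrable (mu := leb2) mS) (cint j k) => u _; ring.
  have ipk := cintegrable_poly (mu := leb2) mS p ik.
  by apply: (eq_cintegrable (mu := leb2) mS) ipk => u _; ring.
exact: (cintegral_poly_scalar (mu := leb2) mS ip).
Qed.

Lemma integrable_w1 (j : nat) :
  leb.-integrable (S1 W) (fun x => (w1 W x * x ^+ j)%:E).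
Proof.
have [m1 _ _ _] := dens1.
exact: integrableS (integrable_weight1 j dens1 dens2 fm m00).
Qed.

Lemma integrable_w2 (k : nat) :
  leb.-integrable (S2 W) (fun y => (w2 W y * y ^+ k)%:E).
Proof.
have [m2 _ _ _] := dens2.
exact: integrableS (integrable_weight2 k dens1 dens2 fm m00).
Qed.

Lemma int1_scalar : scalar (fun p => int1 W (at_real p)).
Proof. have [m1 _ _ _] := dens1; exact: (poly_integral_scalar m1 integrable_w1). Qed.

Lemma int2_scalar : scalar (fun p => int2 W (at_real p)).
Proof. have [m2 _ _ _] := dens2; exact: (poly_integral_scalar m2 integrable_w2). Qed.

Lemma polybracket_XnXn j k : polybracket 'X^j 'X^k = moment W j k.
Proof. by apply: eq_cintegral => u _; rewrite /at_real !hornerXn. Qed.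

(** Both sides are linear in each argument, so monomials suffice, and there it is [moment_add]. *)
Lemma polybracket_add (p q : {poly R[i]}) :
  polybracket ('X * p) q + polybracket p ('X * q) =
  int1 W (at_real p) * int2 W (at_real q).
Proof.
move: p; apply: scalar_poly_ext => [c p p'|c p p'|j].
- rewrite mulrDr -scalerAr polybracket_scalarl (polybracket_scalarl ('X * q)) /=.
  by ring.
- by rewrite int1_scalar /=; ring.
move: q; apply: scalar_poly_ext => [c q q'|c q q'|k].
- by rewrite mulrDr -scalerAr !polybracket_scalarr /=; ring.
- by rewrite int2_scalar /=; ring.
by rewrite -!exprS !polybracket_XnXn moment_add // int1_Xn // int2_Xn.
Qed.

End WeightFunctionals.

(** * Biorthogonal polynomials *)

Section Biorthogonal.
Variables (C : fieldType) (B : {poly C} -> {poly C} -> C).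
Hypothesis Bl : forall q, scalar (B^~ q).
Variables (P Q : nat -> {poly C}) (s : nat -> C).
Hypothesis sizeP : forall n, size (P n) = n.+1.
Hypothesis leadP : forall n, lead_coef (P n) = s n.
Hypothesis s_neq0 : forall n, s n != 0.
Hypothesis BPQ : forall m n, B (P m) (Q n) = (m == n)%:R.

Lemma size_sub_lead (V : nat -> {poly C}) (p : {poly C}) (n : nat) :
  (forall k, size (V k) = k.+1) -> (forall k, lead_coef (V k) = s k) ->
  (size p <= n.+1)%N -> (size (p - (p`_n / s n) *: V n)%R <= n)%N.
Proof.
move=> sV lV sp; apply/leq_sizeP => j; rewrite leq_eqVlt => /predU1P[<-|nj].
  rewrite coefB coefZ; have := lV n; rewrite lead_coefE sV /= => ->.
  by rewrite divfK ?subrr.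
rewrite coefB coefZ (nth_default _ (leq_trans sp nj)).
by rewrite [(V n)`_j]nth_default ?sV // mulr0 subrr.
Qed.

(** Induction on the size bound: removing the top term along the basis [P] leaves a shorter
    polynomial, and each removed basis element has index below [m]. *)
Lemma bracket_orthoP (n m : nat) (p : {poly C}) :
  (size p <= n)%N -> (n <= m)%N -> B p (Q m) = 0.
Proof.
elim: n p => [|n IH] p sp nm.
  move: sp; rewrite leqn0 size_poly_eq0 => /eqP ->.
  by rewrite -(scale0r 0) (is_scalarZ (Bl _)) mul0r.
rewrite -(subrK ((p`_n / s n) *: P n) p) (is_scalarD (Bl _)) (is_scalarZ (Bl _)).
rewrite IH ?size_sub_lead // ?(ltnW nm) //.
by rewrite BPQ (ltn_eqF nm) mulr0 addr0.
Qed.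

Lemma bracket_coefP (m : nat) (p : {poly C}) :
  (size p <= m.+1)%N -> B p (Q m) = p`_m / s m.
Proof.
move=> sp; rewrite -{1}(subrK ((p`_m / s m) *: P m) p).
rewrite (is_scalarD (Bl _)) (is_scalarZ (Bl _)).
by rewrite (@bracket_orthoP m) ?size_sub_lead // BPQ eqxx mulr1 add0r.
Qed.

(** The top coefficient in the basis is a bracket by [bracket_coefP]; subtracting that multiple of
    [P n] leaves the brackets with [Q k], [k < n], unchanged. *)
Lemma biorthogonal_expansion (n : nat) (p : {poly C}) :
  (size p <= n)%N -> p = \sum_(k < n) B p (Q k) *: P k.
Proof.
elim: n p => [|n IH] p sp.
  by rewrite big_ord0; apply/eqP; rewrite -size_poly_eq0 -leqn0.
rewrite big_ord_recr /= bracket_coefP //.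
have := IH _ (size_sub_lead sizeP leadP sp).
move/eqP; rewrite subr_eq => /eqP {1}->; congr (_ + _).
apply: eq_bigr => k _; congr (_ *: _).
rewrite (is_scalarD (Bl _)) -scaleNr (is_scalarZ (Bl _)) BPQ gtn_eqF ?mulr0 ?addr0 //.
Qed.

End Biorthogonal.

(** * Recurrence for multiplication by the variable *)

Section Recurrence.
Variables (C : fieldType) (B : {poly C} -> {poly C} -> C) (I1 I2 : {poly C} -> C).
Hypotheses (Bl : forall q, scalar (B^~ q)) (Br : forall p, scalar (B p)).
Hypothesis BX : forall p q, B ('X * p) q + B p ('X * q) = I1 p * I2 q.
Variables (P Q : nat -> {poly C}) (s : nat -> C).
Hypotheses (sizeP : forall n, size (P n) = n.+1) (sizeQ : forall n, size (Q n) = n.+1).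
Hypotheses (leadP : forall n, lead_coef (P n) = s n)
           (leadQ : forall n, lead_coef (Q n) = s n).
Hypothesis s_neq0 : forall n, s n != 0.
Hypothesis BPQ : forall m n, B (P m) (Q n) = (m == n)%:R.

Let sizeX (V : nat -> {poly C}) (k : nat) :
  (forall k, size (V k) = k.+1) -> size ('X * V k) = k.+2.
Proof. by move=> sV; rewrite mulrC size_mulX ?sV // -size_poly_eq0 sV. Qed.

Let coef_lead (V : nat -> {poly C}) (k : nat) :
  (forall k, size (V k) = k.+1) -> (forall k, lead_coef (V k) = s k) ->
  (V k)`_k = s k.
Proof. by move=> sV lV; have := lV k; rewrite lead_coefE sV. Qed.

(** Exchanging the arguments of [B] makes the results on [P] available for [Q]. *)
Let BQP m n : (fun q p => B p q) (Q m) (P n) = (m == n)%:R.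
Proof. by rewrite /= BPQ eq_sym. Qed.

(* The bracket turns multiplication by x into multiplication by -y up to the
   rank-one term I1 * I2, so the expansion of x * P_m on the basis (P_k) is
   tridiagonal up to that term. *)
Lemma biorthogonal_recurrence (m : nat) :
  'X * P m = (s m / s m.+1) *: P m.+1 - B (P m) ('X * Q m) *: P m
    - (pred_term s m / s m) *: pred_term P m
    + I1 (P m) *: \sum_(k < m.+1) I2 (Q k) *: P k.
Proof.
rewrite (biorthogonal_expansion Bl sizeP leadP s_neq0 BPQ
  (n := m.+2) (p := 'X * P m)) ?sizeX //.
rewrite big_ord_recr /= (bracket_coefP Bl sizeP leadP s_neq0 BPQ) ?sizeX //.
rewrite coefXM /= (coef_lead _ sizeP leadP).
rewrite -!addrA addrC; congr (_ + _).
have BXE k : B ('X * P m) (Q k) = I1 (P m) * I2 (Q k) - B (P m) ('X * Q k).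
  by rewrite -BX addrK.
rewrite (eq_bigr (fun k : 'I_m.+1 => I1 (P m) *: (I2 (Q k) *: P k) -
    B (P m) ('X * Q k) *: P k)); last first.
  by move=> k _; rewrite BXE scalerBl scalerA.
rewrite sumrB -scaler_sumr addrA [RHS]addrC; congr (_ + _).
rewrite big_ord_recr /= opprD addrC; congr (_ + _); congr (- _).
(* For [k < m] the bracket reads off the coefficient of degree [m] of a polynomial of degree
   [k + 1]. Only [k = m - 1] survives, with value [s (m - 1) / s m]. *)
have Bcoef k : (k < m)%N -> B (P m) ('X * Q k) = ('X * Q k)`_m / s m.
  move=> km; apply: (bracket_coefP (B := fun q p => B p q) Br sizeQ leadQ s_neq0 BQP).
  by rewrite sizeX.
case: m BXE Bcoef => [|m] _ Bcoef; first by rewrite big_ord0 /= mul0r scale0r.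
rewrite big_ord_recr /= Bcoef // coefXM /= (coef_lead _ sizeQ leadQ).
rewrite big1 ?add0r => [//|k _].
rewrite (Bcoef k (leqW (ltn_ord k))) coefXM /=.
by rewrite nth_default ?sizeQ // mul0r scale0r.
Qed.

Lemma functional_recurrence (L : {poly C} -> C) (x : C) (l : nat -> C) :
  scalar L -> (forall m, L ('X * P m) = x * L (P m) - l m) -> forall m,
  x * L (P m) = s m / s m.+1 * L (P m.+1) - B (P m) ('X * Q m) * L (P m)
    - pred_term s m / s m * pred_term (fun k => L (P k)) m
    + I1 (P m) * (\sum_(k < m.+1) I2 (Q k) * L (P k)) + l m.
Proof.
move=> LL LX m; apply/eqP; rewrite -subr_eq -LX biorthogonal_recurrence; apply/eqP.
rewrite -!scaleNr !(is_scalarD LL) !(is_scalarZ LL) (is_scalar_sum _ _ _ _ LL) !mulNr.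
by case: m => //=; rewrite !mul0r.
Qed.

Lemma biorthogonal_one (V : nat -> {poly C}) :
  (forall k, size (V k) = k.+1) -> (forall k, lead_coef (V k) = s k) ->
  1 = (s 0%N)^-1 *: V 0%N.
Proof.
move=> sV lV; rewrite [V 0%N]size1_polyC ?sV // -mul_polyC -polyCM.
by rewrite (coef_lead _ sV lV) mulVf.
Qed.

(** This is the defect of the transforms of order 2: since [1] is a multiple of [Q 0], it is
    concentrated at index 0. *)
Lemma bracket_const (m : nat) : B (P m) 1 = (m == 0%N)%:R / s 0%N.
Proof.
by rewrite (biorthogonal_one sizeQ leadQ) (is_scalarZ (Br _)) BPQ mulrC.
Qed.

End Recurrence.

(** * Abstract Christoffel-Darboux identity *)

Section ChristoffelDarboux.
Variable C : fieldType.

(** Here [a l] stands for [s (l - 1) / s l]. The defects [e], [e'] come from order 1, where they are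
    proportional to [pi] or [eta] and just shift the partial sums; [dd], [dd'] come from order 2 and
    enter only at index 0. *)
Lemma christoffel_darboux (p q pi eta X Y a : nat -> C) (x y e e' dd dd' : C) :
  (forall l, x * p l = a l.+1 * p l.+1 - Y l * p l - a l * pred_term p l
     + pi l * (\sum_(k < l.+1) eta k * p k) + (pi l * e + (l == 0%N)%:R * dd)) ->
  (forall l, y * q l = a l.+1 * q l.+1 - X l * q l - a l * pred_term q l
     + eta l * (\sum_(k < l.+1) pi k * q k) + (eta l * e' + (l == 0%N)%:R * dd')) ->
  (forall l, X l + Y l = pi l * eta l) ->
  forall n, (x + y) * (\sum_(l < n.+1) p l * q l) + e * e' - dd * q 0%N - dd' * p 0%N =
    a n.+1 * (p n.+1 * q n + p n * q n.+1)
    + (e + \sum_(k < n.+1) eta k * p k) * (e' + \sum_(k < n.+1) pi k * q k).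
Proof.
move=> Hp Hq XY; elim=> [|n IH].
  have := Hp 0%N; have := Hq 0%N; rewrite !big_ord1 /= !mulr0 !subr0 !mul1r => Hq0 Hp0.
  have -> : (x + y) * (p 0%N * q 0%N) = (x * p 0%N) * q 0%N
    + p 0%N * (y * q 0%N) by ring.
  have XY0 : X 0%N = pi 0%N * eta 0%N - Y 0%N by rewrite -XY addrK.
  by rewrite Hp0 Hq0 XY0; ring.
rewrite big_ord_recr /= mulrDr.
have -> : (x + y) * (p n.+1 * q n.+1) = (x * p n.+1) * q n.+1
    + p n.+1 * (y * q n.+1) by ring.
rewrite Hp Hq /= !mul0r !addr0.
have XY0 : X n.+1 = pi n.+1 * eta n.+1 - Y n.+1 by rewrite -XY addrK.
(* Once [X] is eliminated by [X + Y = pi * eta], the diagonal terms are exactly the increment of the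
   product of the two shifted sums. *)
rewrite XY0 ![\sum_(k < n.+2) _]big_ord_recr /=.
set E := \sum_(k < n.+1) eta k * p k in IH *; set F := \sum_(k < n.+1) pi k * q k in IH *.
set A := (x + y) * _ in IH *.
have -> : A = a n.+1 * (p n.+1 * q n + p n * q n.+1) + (e + E) * (e' + F)
    - e * e' + dd * q 0%N + dd' * p 0%N by rewrite -IH; ring.
ring.
Qed.

End ChristoffelDarboux.

(** * Kernels *)

Lemma det_mx22 (A : comPzRingType) (M : 'M[A]_2) :
  \det M = M 0 0 * M 1 1 - M 0 1 * M 1 0.
Proof.
rewrite (expand_det_row _ 0) !big_ord_recl big_ord0 /cofactor !det_mx11 !mxE /=.
have -> : lift 0 0 = 1 :> 'I_2 by apply/val_inj.
have -> : lift 1 0 = 0 :> 'I_2 by apply/val_inj.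
by rewrite expr0 expr1; ring.
Qed.

(** * Explicit 3 x 3 matrices *)

Section Matrices.
Context {R : realType}.
Implicit Types (a b c : R[i]).

Lemma bilin_mx3 g00 g01 g02 g10 g11 g12 g20 g21 g22 a b c a' b' c' :
  bilin (mx3 [:: [:: g00; g01; g02]; [:: g10; g11; g12]; [:: g20; g21; g22]])
    (col3 a b c) (col3 a' b' c') =
  a * (g00 * a' + g01 * b' + g02 * c') + b * (g10 * a' + g11 * b' + g12 * c')
  + c * (g20 * a' + g21 * b' + g22 * c') :> R[i].
Proof.
rewrite /bilin !mxE !big_ord_recl big_ord0 !mxE !big_ord_recl !big_ord0 !mxE /=.
ring.
Qed.

Lemma det_mx3 g00 g01 g02 g10 g11 g12 g20 g21 g22 :
  \det (mx3 [:: [:: g00; g01; g02]; [:: g10; g11; g12]; [:: g20; g21; g22]]) =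
  g00 * (g11 * g22 - g12 * g21) - g01 * (g10 * g22 - g12 * g20)
  + g02 * (g10 * g21 - g11 * g20) :> R[i].
Proof.
rewrite (expand_det_row _ 0) !big_ord_recl big_ord0 /cofactor !det_mx22 !mxE /=.
ring.
Qed.

Lemma mulmx_mx3 g00 g01 g02 g10 g11 g12 g20 g21 g22
    h00 h01 h02 h10 h11 h12 h20 h21 h22 :
  mx3 [:: [:: g00; g01; g02]; [:: g10; g11; g12]; [:: g20; g21; g22]] *m
  mx3 [:: [:: h00; h01; h02]; [:: h10; h11; h12]; [:: h20; h21; h22]] =
  mx3 [:: [:: g00 * h00 + g01 * h10 + g02 * h20; g00 * h01 + g01 * h11 + g02 * h21;
              g00 * h02 + g01 * h12 + g02 * h22];
          [:: g10 * h00 + g11 * h10 + g12 * h20; g10 * h01 + g11 * h11 + g12 * h21;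
              g10 * h02 + g11 * h12 + g12 * h22];
          [:: g20 * h00 + g21 * h10 + g22 * h20; g20 * h01 + g21 * h11 + g22 * h21;
              g20 * h02 + g21 * h12 + g22 * h22]] :> 'M[R[i]]_3.
Proof.
apply/matrixP => i j; rewrite !mxE !big_ord_recl big_ord0 !mxE addr0 addrA /=.
by case: i => [[|[|[|//]]] ?]; case: j => [[|[|[|//]]] ?].
Qed.

Lemma mx3_scalar a :
  a%:M = mx3 [:: [:: a; 0; 0]; [:: 0; a; 0]; [:: 0; 0; a]] :> 'M[R[i]]_3.
Proof.
apply/matrixP => i j; rewrite !mxE.
by case: i => [[|[|[|//]]] ?]; case: j => [[|[|[|//]]] ?].
Qed.

Lemma mx3_sub g00 g01 g02 g10 g11 g12 g20 g21 g22
    h00 h01 h02 h10 h11 h12 h20 h21 h22 :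
  mx3 [:: [:: g00; g01; g02]; [:: g10; g11; g12]; [:: g20; g21; g22]] -
  mx3 [:: [:: h00; h01; h02]; [:: h10; h11; h12]; [:: h20; h21; h22]] =
  mx3 [:: [:: g00 - h00; g01 - h01; g02 - h02]; [:: g10 - h10; g11 - h11; g12 - h12];
          [:: g20 - h20; g21 - h21; g22 - h22]] :> 'M[R[i]]_3.
Proof.
apply/matrixP => i j; rewrite !mxE.
by case: i => [[|[|[|//]]] ?]; case: j => [[|[|[|//]]] ?].
Qed.

End Matrices.

(** The square of [s n] is a quotient of two nonzero moment determinants. *)
Lemma biorthonormal_lead_neq0 (R : realType) (W : weights R)
    (P Q : nat -> {poly R[i]}) (s : nat -> R[i]) :
  generic W P Q -> biorthonormal W P Q s -> forall n, s n != 0.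
Proof.
move=> [_ Z0 _ _] [_ _ sZ _] n; apply/eqP => s0.
have := sZ n; rewrite s0 expr0n /= => /esym/eqP; apply/negP.
by rewrite mulf_neq0 ?invr_neq0.
Qed.

(** * Transforms of orders 0, 1, 2 and the bilinear form *)

Section Kernel.
Context {R : realType}.
Variables (W : weights R) (P Q : nat -> {poly R[i]}) (s : nat -> R[i]).
Hypotheses (dens1 : is_density (S1 W) (w1 W)) (dens2 : is_density (S2 W) (w2 W)).
Hypotheses (gen : generic W P Q) (bio : biorthonormal W P Q s).

Let fm : finite_moments W. Proof. by have [] := gen. Qed.
Let sizeP n : size (P n) = n.+1. Proof. by have [/(_ n)[]] := bio. Qed.
Let sizeQ n : size (Q n) = n.+1. Proof. by have [/(_ n)[]] := bio. Qed.
Let leadP n : lead_coef (P n) = s n. Proof. by have [_ /(_ n)[]] := bio. Qed.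
Let leadQ n : lead_coef (Q n) = s n. Proof. by have [_ /(_ n)[]] := bio. Qed.
Let BPQ m n : polybracket W (P m) (Q n) = (m == n)%:R.
Proof. by have [_ _ _] := bio; exact. Qed.
Let BQP m n : polybracket W (P n) (Q m) = (m == n)%:R.
Proof. by rewrite BPQ eq_sym. Qed.

Let s_neq0 := biorthonormal_lead_neq0 gen bio.

(** This moment is the determinant [Z W 1]; its nonvanishing gives integrability of each density
    separately. *)
Let m00 : moment W 0 0 != 0.
Proof.
have [_ /(_ 1%N) Z1 _ _] := gen; move: Z1.
by rewrite /Z det_mx11 mxE.
Qed.

Let Bl := polybracket_scalarl dens1 dens2 fm.
Let Br := polybracket_scalarr dens1 dens2 fm.
Let BX := polybracket_add dens1 dens2 fm m00.

Lemma X_E n : X_ W P Q n = polybracket W ('X * P n) (Q n).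
Proof. by apply: eq_cintegral => u _; rewrite /at_real hornerM hornerX. Qed.

Lemma Y_E n : Y_ W P Q n = polybracket W (P n) ('X * Q n).
Proof. by apply: eq_cintegral => u _; rewrite /at_real hornerM hornerX. Qed.

Lemma X_Y_add n : X_ W P Q n + Y_ W P Q n = pi_ W P n * eta_ W Q n.
Proof. by rewrite X_E Y_E BX. Qed.

Let mS : measurable (S1 W `*` S2 W).
Proof. by have [m1 _ _ _] := dens1; have [m2 _ _ _] := dens2; exact: measurableX. Qed.

Definition bracket_weight (u : R * R) : R := w1 W u.1 * w2 W u.2 / (u.1 + u.2).

(** The functional is evaluation at [x] for order 0, the Cauchy integral on [S1] for order 1, and
    the one on [S1 x S2] along [fst] for order 2. Its value at 1 is recorded because [P 0] is
    constant, which is how [f1] and [g1] enter the kernels. *)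
Lemma Pfun_functional (mu : nat) (x : R[i]) :
  (mu <= 2)%N -> in_dom (S1 W) mu x ->
  exists L : {poly R[i]} -> R[i],
  [/\ scalar L, forall n, Defs.Pfun W P mu n x = L (P n),
      forall p, L ('X * p) = x * L p - ((mu == 1%N)%:R * int1 W (at_real p) +
        (mu == 2%N)%:R * polybracket W p 1) &
      L 1 = match mu with 0 => 1 | 1 => f1 W x | _ => g1 W x end].
Proof.
have [m1 _ _ _] := dens1; case: mu => [|[|[|//]]] _ xD.
- exists (horner_eval x); split=> // [|p|]; first exact: linearP.
    by rewrite /horner_eval hornerM hornerX !mul0r addr0 subr0.
  by rewrite /horner_eval hornerC.
- have mom := integrable_w1 dens1 dens2 fm m00.
  exists (cauchy_integral leb (S1 W) (w1 W) id x); split=> // [|p|].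
  + exact: (cauchy_integral_scalar m1 mom (@measurable_id _ _ _) (fun _ => id) xD).
  + rewrite (cauchy_integralX m1 mom (@measurable_id _ _ _) (fun _ => id) xD).
    by rewrite mul1r mul0r addr0.
  + by apply: eq_cintegral => t _; rewrite hornerC mul1r.
have mom j : leb2.-integrable (S1 W `*` S2 W)
    (fun u => (bracket_weight u * u.1 ^+ j)%:E).
  by apply: (eq_integrable (mu := leb2) mS) (fm j 0) => u _; rewrite expr0 mulr1.
have mfst : measurable_fun (S1 W `*` S2 W) (@fst R R).
  exact: (measurable_funS measurableT _ measurable_fst).
have fstS u : (S1 W `*` S2 W) u -> S1 W u.1 by case.
have xD1 : in_dom (S1 W) 1 x by move=> _; exact: xD.
exists (cauchy_integral leb2 (S1 W `*` S2 W) bracket_weight fst x); split.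
- exact: (cauchy_integral_scalar (mu := leb2) mS mom mfst fstS xD1).
- by move=> n; apply: eq_cintegral => u _; rewrite mulr1.
- move=> p; rewrite (cauchy_integralX (mu := leb2) mS mom mfst fstS xD1).
  rewrite mul0r mul1r add0r; congr (_ - _).
  by apply: eq_cintegral => u _; rewrite /at_real hornerC mulr1.
by apply: eq_cintegral => u _; rewrite hornerC mul1r mulr1.
Qed.

Lemma Qfun_functional (nu : nat) (y : R[i]) :
  (nu <= 2)%N -> in_dom (S2 W) nu y ->
  exists L : {poly R[i]} -> R[i],
  [/\ scalar L, forall n, Qfun W Q nu n y = L (Q n),
      forall q, L ('X * q) = y * L q - ((nu == 1%N)%:R * int2 W (at_real q) +
        (nu == 2%N)%:R * polybracket W 1 q) &
      L 1 = match nu with 0 => 1 | 1 => f2 W y | _ => g2 W y end].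
Proof.
have [m2 _ _ _] := dens2; case: nu => [|[|[|//]]] _ yD.
- exists (horner_eval y); split=> // [|p|]; first exact: linearP.
    by rewrite /horner_eval hornerM hornerX !mul0r addr0 subr0.
  by rewrite /horner_eval hornerC.
- have mom := integrable_w2 dens1 dens2 fm m00.
  exists (cauchy_integral leb (S2 W) (w2 W) id y); split=> // [|p|].
  + exact: (cauchy_integral_scalar m2 mom (@measurable_id _ _ _) (fun _ => id) yD).
  + rewrite (cauchy_integralX m2 mom (@measurable_id _ _ _) (fun _ => id) yD).
    by rewrite mul1r mul0r addr0.
  + by apply: eq_cintegral => t _; rewrite hornerC mul1r.
have mom j : leb2.-integrable (S1 W `*` S2 W)
    (fun u => (bracket_weight u * u.2 ^+ j)%:E).
  by apply: (eq_integrable (mu := leb2) mS) (fm 0 j) => u _; rewrite expr0 mulr1.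
have msnd : measurable_fun (S1 W `*` S2 W) (@snd R R).
  exact: (measurable_funS measurableT _ measurable_snd).
have sndS u : (S1 W `*` S2 W) u -> S2 W u.2 by case.
have yD1 : in_dom (S2 W) 1 y by move=> _; exact: yD.
exists (cauchy_integral leb2 (S1 W `*` S2 W) bracket_weight snd y); split.
- exact: (cauchy_integral_scalar (mu := leb2) mS mom msnd sndS yD1).
- by move=> n; apply: eq_cintegral => u _; rewrite mulr1.
- move=> p; rewrite (cauchy_integralX (mu := leb2) mS mom msnd sndS yD1).
  rewrite mul0r mul1r add0r; congr (_ - _).
  by apply: eq_cintegral => u _; rewrite /at_real hornerC mulr1.
by apply: eq_cintegral => u _; rewrite hornerC mul1r mulr1.
Qed.

Lemma Pfun_recurrence (mu : nat) (x : R[i]) :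
  (mu <= 2)%N -> in_dom (S1 W) mu x -> forall l,
  x * Defs.Pfun W P mu l x =
    s l / s l.+1 * Defs.Pfun W P mu l.+1 x - Y_ W P Q l * Defs.Pfun W P mu l x
    - pred_term s l / s l * pred_term (fun k => Defs.Pfun W P mu k x) l
    + pi_ W P l * (\sum_(k < l.+1) eta_ W Q k * Defs.Pfun W P mu k x)
    + (pi_ W P l * (mu == 1%N)%:R + (l == 0%N)%:R * ((mu == 2%N)%:R / s 0%N)).
Proof.
move=> mu2 xD l; have [L [LL LP LX _]] := Pfun_functional mu2 xD.
have LX' m : L ('X * P m) = x * L (P m) - (pi_ W P m * (mu == 1%N)%:R +
    (m == 0%N)%:R * ((mu == 2%N)%:R / s 0%N)).
  rewrite LX (bracket_const Br sizeQ leadQ s_neq0 BPQ) /pi_.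
  by congr (_ - (_ + _)); ring.
have := functional_recurrence Bl Br BX sizeP sizeQ leadP leadQ s_neq0 BPQ LL LX' l.
rewrite Y_E !LP => ->.
rewrite (_ : pred_term (fun k => Defs.Pfun _ _ _ _ _) l =
             pred_term (fun k => L (P k)) l);
  last by case: (l) => //= k; exact: LP.
by under [in RHS]eq_bigr do rewrite LP.
Qed.

Lemma Qfun_recurrence (nu : nat) (y : R[i]) :
  (nu <= 2)%N -> in_dom (S2 W) nu y -> forall l,
  y * Qfun W Q nu l y =
    s l / s l.+1 * Qfun W Q nu l.+1 y - X_ W P Q l * Qfun W Q nu l y
    - pred_term s l / s l * pred_term (fun k => Qfun W Q nu k y) l
    + eta_ W Q l * (\sum_(k < l.+1) pi_ W P k * Qfun W Q nu k y)
    + (eta_ W Q l * (nu == 1%N)%:R + (l == 0%N)%:R * ((nu == 2%N)%:R / s 0%N)).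
Proof.
move=> nu2 yD l; have [L [LL LQ LX _]] := Qfun_functional nu2 yD.
(* The recurrence for [Q] is the abstract one for the flipped bracket, with the two single integrals
   exchanged. *)
pose B' q p := polybracket W p q.
have BX' p q : B' ('X * p) q + B' p ('X * q) = int2 W (at_real p) * int1 W (at_real q).
  by rewrite addrC BX mulrC.
have LX' m : L ('X * Q m) = y * L (Q m) - (eta_ W Q m * (nu == 1%N)%:R +
    (m == 0%N)%:R * ((nu == 2%N)%:R / s 0%N)).
  rewrite LX -[polybracket W 1 _]/(B' (Q m) 1).
  rewrite (bracket_const (B := B') Bl sizeP leadP s_neq0 BQP) /eta_.
  by congr (_ - (_ + _)); ring.
have := functional_recurrence (B := B') Br Bl BX' sizeQ sizeP leadQ leadP s_neq0
  BQP LL LX' l.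
rewrite X_E !LQ /B' => ->.
rewrite (_ : pred_term (fun k => Qfun _ _ _ _ _) l =
             pred_term (fun k => L (Q k)) l);
  last by case: (l) => //= k; exact: LQ.
by under [in RHS]eq_bigr do rewrite LQ.
Qed.

Lemma Pfun_zero (mu : nat) (x : R[i]) : (mu <= 2)%N -> in_dom (S1 W) mu x ->
  Defs.Pfun W P mu 0 x / s 0 = match mu with 0 => 1 | 1 => f1 W x | _ => g1 W x end.
Proof.
move=> mu2 xD; have [L [LL -> _ <-]] := Pfun_functional mu2 xD.
by rewrite (biorthogonal_one s_neq0 sizeP leadP) (is_scalarZ LL) mulrC.
Qed.

Lemma Qfun_zero (nu : nat) (y : R[i]) : (nu <= 2)%N -> in_dom (S2 W) nu y ->
  Qfun W Q nu 0 y / s 0 = match nu with 0 => 1 | 1 => f2 W y | _ => g2 W y end.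
Proof.
move=> nu2 yD; have [L [LL -> _ <-]] := Qfun_functional nu2 yD.
by rewrite (biorthogonal_one s_neq0 sizeQ leadQ) (is_scalarZ LL) mulrC.
Qed.

(* Stated before division by x + y, so that it also covers x + y = 0. *)
Lemma kernel_bilin (mu nu n : nat) (x y : R[i]) :
  (mu <= 2)%N -> (nu <= 2)%N -> in_dom (S1 W) mu x -> in_dom (S2 W) nu y ->
  (0 < n)%N || ((mu <= 1)%N && (nu <= 1)%N) ->
  pi_ W P n * eta_ W Q n *
    ((x + y) * (\sum_(l < n.+1) Defs.Pfun W P mu l x * Qfun W Q nu l y)
     + (mu == 1%N)%:R * (nu == 1%N)%:R
     - (mu == 2%N)%:R / s 0 * Qfun W Q nu 0 y
     - (nu == 2%N)%:R / s 0 * Defs.Pfun W P mu 0 x) =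
  bilin (G W P Q s n x y) (Pvec W P mu n x) (Qvec W Q nu n y).
Proof.
move=> mu2 nu2 xD yD n_mu_nu.
have HP := Pfun_recurrence mu2 xD; have HQ := Qfun_recurrence nu2 yD.
rewrite (@christoffel_darboux _ (fun l => Defs.Pfun W P mu l x)
  (fun l => Qfun W Q nu l y) (pi_ W P) (eta_ W Q) (X_ W P Q) (Y_ W P Q)
  (fun l => pred_term s l / s l)) //; last exact: X_Y_add.
rewrite bilin_mx3.
have {}HP := HP n; have {}HQ := HQ n.
(* The relations at index [n] are about to be used; the side condition on [n], [mu], [nu] says that
   their order-2 defect is absent there. *)
have dP : (n == 0%N)%:R * ((mu == 2%N)%:R / s 0) = 0.
  case: (n) n_mu_nu => [|k] //=; rewrite ?mul0r // => /andP[+ _].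
  by case: (mu) => [|[|]] //; rewrite !mul0r mulr0.
have dQ : (n == 0%N)%:R * ((nu == 2%N)%:R / s 0) = 0.
  case: (n) n_mu_nu => [|k] //=; rewrite ?mul0r // => /andP[_].
  by case: (nu) => [|[|]] //; rewrite !mul0r mulr0.
rewrite dP addr0 in HP; rewrite dQ addr0 in HQ.
move: HP HQ; rewrite /=.
set SP := \sum_(k < _) _; set SQ := \sum_(k < _) _.
set e1 := (mu == 1%N)%:R; set e2 := (nu == 1%N)%:R.
set p1 := Defs.Pfun _ _ _ n.+1 _; set p0 := Defs.Pfun _ _ _ n _.
set q1 := Qfun _ _ _ n.+1 _; set q0 := Qfun _ _ _ n _.
have := X_Y_add n; set X := X_ _ _ _ _; set Y := Y_ _ _ _ _.
set p := pi_ _ _ _; set h := eta_ _ _ _ => XY HP HQ.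
have EP : p * (e1 + SP) = (x + Y) * p0 - s n / s n.+1 * p1
    + pred_term s n / s n * pred_term (fun k => Defs.Pfun W P mu k x) n.
  by rewrite mulrDl HP; ring.
have EQ : h * (e2 + SQ) = (y + X) * q0 - s n / s n.+1 * q1
    + pred_term s n / s n * pred_term (fun k => Qfun W Q nu k y) n.
  by rewrite mulrDl HQ; ring.
(* The factor [pi_n eta_n] splits over the two shifted sums, and each becomes a combination of three
   consecutive terms. So [G] is the rank-one matrix [comp_hatP *m comp_checkQ^T] plus
   [pi_n eta_n s_n / s_(n+1)] in the positions (1,2) and (2,1). *)
rewrite mulrDr [X in _ + X](_ : _ = (p * (e1 + SP)) * (h * (e2 + SQ))); last by ring.
rewrite EP EQ -XY.
have := s_neq0 n; have := s_neq0 n.+1 => sp0 s00.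
by field; rewrite sp0 s00.
Qed.

End Kernel.

Theorem proposition3p9 (R : realType) (W : weights R)
    (P Q : nat -> {poly R[i]}) (s : nat -> R[i])
    (dens1 : is_density (S1 W) (w1 W)) (dens2 : is_density (S2 W) (w2 W))
    (gen : generic W P Q) (bio : biorthonormal W P Q s) (n : nat) :
  let pe := pi_ W P n * eta_ W Q n in
  let X := X_ W P Q n in let Y := Y_ W P Q n in
  let sm := pred_term s n in let s0 := s n in let sp := s n.+1 in
  (* bilinear form of the kernels; at n = 0 only for mu, nu <= 1 *)
  (forall (mu nu : 'I_3) (x y : R[i]),
      in_dom (S1 W) mu x -> in_dom (S2 W) nu y ->
      (0 < n)%N || ((mu <= 1)%N && (nu <= 1)%N) ->
      (mu + nu <= 1)%N || (x + y != 0) ->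
      pe * (x + y) * CDkernel W P Q mu nu n x y =
      bilin (G W P Q s n x y) (Pvec W P mu n x) (Qvec W Q nu n y)) /\
  (* last column and last row *)
  (forall x : R[i],
      pi_ W P n * (hatP W P Q n).[x] =
      s0 / sp * (P n.+1).[x] - (Y + x) * (P n).[x]
        - sm / s0 * (pred_term P n).[x]) /\
  (forall y : R[i],
      eta_ W Q n * (checkQ W P Q n).[y] =
      s0 / sp * (Q n.+1).[y] - (X + y) * (Q n).[y]
        - sm / s0 * (pred_term Q n).[y]) /\
  (exists c : R[i], ((0 < n)%N -> c != 0) /\
      forall x y, col ord_max (G W P Q s n x y) = c *: comp_hatP W P Q s n x) /\
  (exists c : R[i], ((0 < n)%N -> c != 0) /\
      forall x y,
        row ord_max (G W P Q s n x y) = c *: (comp_checkQ W P Q s n y)^T) /\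
  (* spectral curve *)
  (forall x y lambda : R[i],
      \det (G W P Q s n x y - lambda%:M) =
      - lambda ^+ 3
      + (s0 ^+ 2 / sp ^+ 2 + sm ^+ 2 / s0 ^+ 2 + (Y + x) * (X + y))
          * lambda ^+ 2
      - pe * (s0 ^+ 2 / sp ^+ 2) * (x + y) * lambda
      - pe ^+ 2 * (sm ^+ 2 / sp ^+ 2)) /\
  (* anti-incidence; the value for mu = nu = 1 is pi_n eta_n *)
  (forall (mu nu : 'I_2) (x : R[i]),
      in_dom (S1 W) mu x -> in_dom (S2 W) nu (- x) ->
      bilin (G W P Q s n x (- x)) (Pvec W P mu n x) (Qvec W Q nu n (- x)) =
      if (mu == 1%N :> nat) && (nu == 1%N :> nat) then pe else 0) /\
  (* inverse *)
  ((0 < n)%N -> forall x y : R[i],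
      G W P Q s n x y \in unitmx /\
      pe *: invmx (G W P Q s n x y) = Ginv W P Q s n x y).
Proof.
move=> pe X Y sm s0 sp.
have [_ _ pi0 eta0] := gen.
have pe0 : pe != 0 by rewrite mulf_neq0.
have XY : X + Y = pe := X_Y_add dens1 dens2 gen n.
have sp0 : sp != 0 := biorthonormal_lead_neq0 gen bio n.+1.
have s00 : s0 != 0 := biorthonormal_lead_neq0 gen bio n.
have sm0 : (0 < n)%N -> sm != 0.
  by rewrite /sm; case: (n) => // m _; exact: (biorthonormal_lead_neq0 gen bio m).
split; [|split; [|split; [|split; [|split; [|split; [|split]]]]]].
- move=> mu nu x y xD yD nmn xy.
  have mu2 : (mu <= 2)%N by rewrite -ltnS.
  have nu2 : (nu <= 2)%N by rewrite -ltnS.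
  rewrite -(kernel_bilin dens1 dens2 gen bio mu2 nu2 xD yD nmn) -mulrA; congr (_ * _).
  rewrite /CDkernel mulrDr -!addrA; congr (_ + _).
  have HP := Pfun_zero dens1 dens2 gen bio mu2 xD.
  have HQ := Qfun_zero dens1 dens2 gen bio nu2 yD.
  (* Moving [1 / s 0] onto the terms of index 0 turns them into 1, [f1], [g1] and 1, [f2], [g2]. *)
  have div_mulAC (a b c : R[i]) : a / b * c = a * (c / b) by rewrite mulrAC -mulrA.
  rewrite !div_mulAC HP HQ {HP HQ xD yD nmn}.
  (* When [mu + nu <= 1] the additive term of the kernel is 0; otherwise [x + y != 0] cancels its
     denominator. *)
  case: mu nu mu2 nu2 xy => [[|[|[|//]]] ?] [[|[|[|//]]] ?] _ _ /= xy;
    rewrite ?(mulr0, mul0r, mul1r, mulr1, subr0, sub0r, addr0, add0r, oppr0) //;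
    by field.
- move=> x; have D0 : in_dom (S1 W) 0 x by [].
  have := Pfun_recurrence dens1 dens2 gen bio (leq0n 2) D0 n.
  rewrite /hatP /= !mulr0 mul0r mulr0 !addr0 -/X -/Y -/sm -/s0 -/sp => E.
  rewrite hornerN horner_sum.
  under eq_bigr do rewrite hornerZ.
  rewrite (_ : (pred_term P n).[x] = pred_term (fun k => (P k).[x]) n); last first.
    by case: (n) => //=; rewrite horner0.
  by rewrite mulrDl E; ring.
- move=> y; have D0 : in_dom (S2 W) 0 y by [].
  have := Qfun_recurrence dens1 dens2 gen bio (leq0n 2) D0 n.
  rewrite /checkQ /= !mulr0 mul0r mulr0 !addr0 -/X -/Y -/sm -/s0 -/sp => E.
  rewrite hornerN horner_sum.
  under eq_bigr do rewrite hornerZ.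
  rewrite (_ : (pred_term Q n).[y] = pred_term (fun k => (Q k).[y]) n); last first.
    by case: (n) => //=; rewrite horner0.
  by rewrite mulrDl E; ring.
(* The last column meets only the rank-one part of [G], so the factor is the last entry of
   [comp_checkQ]; it vanishes at [n = 0], where [sm = 0]. The last row is symmetric. *)
- exists (- (sm / s0)); split=> [n0|x y].
    by rewrite oppr_eq0 mulf_neq0 ?invr_eq0 ?sm0.
  apply/matrixP => i j; rewrite !mxE /= -/X -/Y -/sm -/s0 -/sp.
  by case: i => [[|[|[|//]]] ?] /=; field; rewrite ?s00 ?sp0.
- exists (- (sm / s0)); split=> [n0|x y].
    by rewrite oppr_eq0 mulf_neq0 ?invr_eq0 ?sm0.
  apply/matrixP => i j; rewrite !mxE /= -/X -/Y -/sm -/s0 -/sp.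
  by case: j => [[|[|[|//]]] ?] /=; field; rewrite ?s00 ?sp0.
(* Writing [pe] as [X + Y] makes this a rational identity in independent variables. *)
- move=> x y lambda; rewrite mx3_scalar /G -/X -/Y -/sm -/s0 -/sp.
  rewrite mx3_sub det_mx3 -XY.
  by field; rewrite ?s00 ?sp0.
- move=> mu nu x xD yD.
  have mu1 : (mu <= 1)%N by rewrite -ltnS.
  have nu1 : (nu <= 1)%N by rewrite -ltnS.
  rewrite -(kernel_bilin dens1 dens2 gen bio (leqW mu1) (leqW nu1) xD yD); last first.
    by rewrite mu1 nu1 orbT.
  (* At [y = -x] the factor [x + y] kills the sum, and the order-2 terms are absent; only the
     boundary constant of [mu = nu = 1] remains. *)
  rewrite subrr mul0r add0r.
  rewrite (ltn_eqF (ltn_ord mu)) (ltn_eqF (ltn_ord nu)) !mul0r !subr0.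
  by case: eqP; case: eqP; rewrite ?mulr1 ?mulr0.
move=> n0 x y; have sm00 := sm0 n0.
(* An entrywise product with [pe = X + Y]; [n > 0] provides [sm != 0], and dividing by [pe] gives a
   one-sided inverse, which suffices for a square matrix. *)
have GG : G W P Q s n x y *m Ginv W P Q s n x y = pe%:M.
  rewrite /G /Ginv -/X -/Y -/sm -/s0 -/sp mulmx_mx3 mx3_scalar -XY.
  apply/matrixP => i j; rewrite !mxE.
  by case: i => [[|[|[|//]]] ?]; case: j => [[|[|[|//]]] ?] /=;
    field; rewrite ?s00 ?sp0 ?sm00.
have G1 : G W P Q s n x y *m (pe^-1 *: Ginv W P Q s n x y) = 1%:M.
  by rewrite -scalemxAr GG scale_scalar_mx mulVf.
have [Gu _] := mulmx1_unit G1; split=> //.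
by rewrite -[invmx _]mulmx1 -G1 mulKmx // scalerA divff // scale1r.
Qed.
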